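(* Let $\mathbb{S}^1=\mathbb{R}/\mathbb{Z}$ with its usual distance $\operatorname{dist}_S$, let $a_n=e^{-n}$ for integers $n\geq 1$, let $M=\mathbb{S}^1\times(\{a_n : n\geq 1\}\cup\{0\})$ with the distance $\operatorname{dist}((x_1,y_1),(x_2,y_2))=\max\{\operatorname{dist}_S(x_1,x_2),|y_2-y_1|\}$, and let $f\colon M\to M$ be the homeomorphism $f(x,y)=(x+y,y)$ (first coordinate taken modulo $1$). Then the polynomial entropy of $f$ is $h_{pol}(f)=0$.
   Context: The usual distance on $\mathbb{R}/\mathbb{Z}$ is $\operatorname{dist}_S(x,y)=\min_{k\in\mathbb{Z}}|x-y+k|$. Polynomial entropy of a homeomorphism $f$ of a compact metric space $(X,\operatorname{dist})$: for $n\geq 1$ and $\varepsilon>0$, a set $E\subset X$ is $(n,\varepsilon)$-spanning for $f$ if for each $y\in X$ there is $x\in E$ with $\operatorname{dist}(f^k(x),f^k(y))\leq\varepsilon$ for all $0\leq k\leq n-1$. Let $r_n(\varepsilon)$ be the minimum cardinality of an $(n,\varepsilon)$-spanning set. Define $h_{pol}^{\varepsilon}(f)=\limsup_{n\to\infty}\frac{\log r_n(\varepsilon)}{\log n}$ and $h_{pol}(f)=\lim_{\varepsilon\to 0}h_{pol}^{\varepsilon}(f)\in[0,\infty]$ (the limit exists by monotonicity in $\varepsilon$). *)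

(* Defs.v *)
From HB Require Import structures.
From mathcomp Require Import all_boot all_order all_algebra.
From mathcomp Require Import all_classical all_reals all_analysis.
From mathcomp Require Import generic_quotient ring_quotient.
From mathcomp Require Import lra.

Set Implicit Arguments.
Unset Strict Implicit.
Unset Printing Implicit Defensive.

Import Order.TTheory GRing.Theory Num.Def Num.Theory.
Import numFieldNormedType.Exports.

Local Open Scope classical_set_scope.
Local Open Scope ring_scope.
Local Open Scope quotient_scope.

Definition homeomorphism (X Y : topologicalType) (f : X -> Y) : Prop :=
  exists g : Y -> X,
    [/\ cancel f g, cancel g f, continuous f & continuous g].

Section PolynomialEntropy.
Context (R : realType) (X : metricType R) (f : X -> X).

Definition spanning (n : nat) (eps : R) (E : set X) : Prop :=
  forall y, exists2 x, E x &
    forall k, (k < n)%N -> mdist (iter k f x) (iter k f y) <= eps.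

(* The set of cardinalities consists of naturals and +oo, so that its infimum
   is a minimum; it is finite when X is compact and f continuous. *)
Definition span_num (n : nat) (eps : R) : \bar R :=
  ereal_inf [set counting E | E in spanning n eps].

(* The terms of index 0 and 1, where the denominator vanishes, do not affect
   the limit superior. *)
Definition pol_entropy_eps (eps : R) : \bar R :=
  limn_esup (fun n => (lne (span_num n eps) / (ln n%:R)%:E)%E).

Definition pol_entropy : \bar R :=
  lim (pol_entropy_eps eps @[eps --> 0^'+]).

End PolynomialEntropy.

Section PolynomialEntropyTheory.
Context (R : realType) (X : metricType R) (f : X -> X).

Lemma span_num_ge0 n (e : R) : (0 <= span_num f n e)%E.
Proof. by apply: le_ereal_inf_tmp => _ [E _ <-]; rewrite /counting; case: ifP.
Qed.

Lemma span_num_le n (e e' : R) :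
  e <= e' -> (span_num f n e' <= span_num f n e)%E.
Proof.
move=> ee'; apply: ereal_inf_le_tmp => _ [E sE <-].
exists E => // y; have [x Ex Px] := sE y; exists x => // k kn.
by rewrite (le_trans (Px k kn)).
Qed.

Lemma pol_entropy_eps_le (e e' : R) :
  e <= e' -> (pol_entropy_eps f e' <= pol_entropy_eps f e)%E.
Proof.
move=> ee'; apply: le_ereal_inf_tmp => _ [V V1 <-].
apply: ge_ereal_inf; eexists; first by exists V.
apply: ge_ereal_sup => _ [n Vn <-]; apply: le_trans (ereal_sup_ubound _); last first.
  by exists n.
apply: lee_wpmul2r.
  rewrite inve_ge0 lee_fin; case: n {Vn} => [|n]; first by rewrite ln0.
  by rewrite ln_ge0// ler1n.
by rewrite lee_lne ?span_num_le// in_itv/= leey andbT span_num_ge0.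
Qed.

Lemma is_cvg_pol_entropy : cvg (pol_entropy_eps f eps @[eps --> 0^'+]).
Proof.
apply: nonincreasing_at_right_is_cvge; near=> x => a b _ _.
exact: pol_entropy_eps_le.
Unshelve. all: by end_near. Qed.

End PolynomialEntropyTheory.

Section Circle.
Context (R : realType).

Definition is_integer : {pred R} := fun x => x \is a Num.int.

Let is_integer_zmod_closed : zmod_closed is_integer.
Proof. by split=> [|x y xZ yZ]; [exact: rpred0|exact: rpredB]. Qed.

HB.instance Definition _ :=
  GRing.isZmodClosed.Build R is_integer is_integer_zmod_closed.

Definition circle : Type := Quotient.quot is_integer.

HB.instance Definition _ := GRing.Zmodule.on circle.
HB.instance Definition _ := Quotient.on circle.

Definition to_circle (t : R) : circle := \pi_circle t.

Lemma to_circleD (s t : R) : to_circle (s + t) = to_circle s + to_circle t.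
Proof. exact: pi_addr. Qed.

Lemma to_circleN (t : R) : to_circle (- t) = - to_circle t.
Proof. exact: pi_oppr. Qed.

Lemma to_circleP (s t : R) :
  reflect (exists k : int, s = t + k%:~R) (to_circle s == to_circle t).
Proof.
rewrite -Quotient.idealrBE; apply: (iffP intrP) => -[k sk]; exists k.
  by rewrite -sk addrC subrK.
by rewrite sk addrC addKr.
Qed.

Lemma reprK_circle (x : circle) : to_circle (repr x) = x.
Proof. exact: reprK. Qed.

Definition circle_dist (x y : circle) : R :=
  inf [set `|repr x - repr y + k%:~R| | k in [set: int]].

Lemma circle_dist_le (s t : R) :
  circle_dist (to_circle s) (to_circle t) <= `|s - t|.
Proof.
have /eqP/to_circleP[k sk] := reprK_circle (to_circle s).
have /eqP/to_circleP[l tl] := reprK_circle (to_circle t).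
apply: ge_inf; first by exists 0 => _ [j _ <-]; exact: normr_ge0.
exists (l - k) => //; rewrite sk tl intrB; congr `| _ |; lra.
Qed.

Let circle_dist_leP x y s t :
  to_circle s = x -> to_circle t = y -> circle_dist x y <= `|s - t|.
Proof. by move=> <- <-; exact: circle_dist_le. Qed.

Let reprD_circle x (k : int) : to_circle (repr x + k%:~R) = x.
Proof. by rewrite -[RHS]reprK_circle; apply/eqP/to_circleP; exists k. Qed.

Lemma circle_dist_attained (x y : circle) :
  exists k : int, circle_dist x y = `|repr x - repr y + k%:~R|.
Proof.
set d := repr x - repr y; pose j := Num.floor (d + 2^-1).
exists (- j); apply/eqP; rewrite eq_le; apply/andP; split.
  by apply: ge_inf; [exists 0 => _ [k _ <-]; exact: normr_ge0|exists (- j)].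
apply: lb_le_inf; first by exists `|d + 0%:~R|, 0.
move=> _ [k _ <-]; rewrite -/d.
have /andP[j1 j2] := floor_itv (d + 2^-1).
rewrite -/j in j1 j2.
have [->//|kj] := eqVneq k (- j).
have : 1 <= `|(k + j)%:~R| :> R.
  by rewrite -intr_norm ler1z -gtz0_ge1 normr_gt0 addr_eq0.
have jd : `|d + (- j)%:~R| <= 2^-1.
  by rewrite intrN ler_norml; rewrite intrD in j2; apply/andP; split; lra.
have -> : (k + j)%:~R = (d + k%:~R) - (d + (- j)%:~R) :> R.
  by rewrite intrD intrN; lra.
by have := ler_normB (d + k%:~R) (d + (- j)%:~R); lra.
Qed.

Let circle_distxx x : circle_dist x x = 0.
Proof.
apply/eqP; rewrite eq_le; apply/andP; split.
  by have := circle_dist_leP (reprK_circle x) (reprK_circle x); rewrite subrr normr0.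
by have [k ->] := circle_dist_attained x x.
Qed.

Let circle_dist_positivity x y : circle_dist x y = 0 -> x = y.
Proof.
have [k ->] := circle_dist_attained x y => /normr0_eq0 xyk.
rewrite -[x]reprK_circle -[y]reprK_circle; apply/eqP/to_circleP.
by exists (- k); rewrite intrN; lra.
Qed.

Let circle_dist_sym_le x y : circle_dist x y <= circle_dist y x.
Proof.
have [k ->] := circle_dist_attained y x.
have := circle_dist_leP (reprK_circle x) (reprD_circle y k).
by rewrite distrC addrAC.
Qed.

Let circle_dist_sym x y : circle_dist x y = circle_dist y x.
Proof. by apply/eqP; rewrite eq_le !circle_dist_sym_le. Qed.

Let circle_dist_triangle y x z :
  circle_dist x z <= circle_dist x y + circle_dist y z.
Proof.
have [k ->] := circle_dist_attained x y.
have [l ->] := circle_dist_attained y z.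
apply: le_trans (circle_dist_leP (reprD_circle x (k + l)) (reprK_circle z)) _.
apply: le_trans (ler_normD _ _).
by rewrite intrD le_eqVlt; apply/orP; left; apply/eqP; congr `| _ |; lra.
Qed.

HB.instance Definition _ := isMetric.Build R circle
  circle_distxx circle_dist_positivity circle_dist_sym circle_dist_triangle.

Lemma mdist_circleE (x y : circle) : mdist x y = circle_dist x y.
Proof. by []. Qed.

Lemma mdist_circleD (x x' y y' : circle) :
  mdist (x + y) (x' + y') <= mdist x x' + mdist y y'.
Proof.
have [k xk] := circle_dist_attained x x'.
have [l yl] := circle_dist_attained y y'.
rewrite !mdist_circleE xk yl.
have xyE : to_circle (repr x + k%:~R + (repr y + l%:~R)) = x + y.
  by rewrite to_circleD !reprD_circle.
have xyE' : to_circle (repr x' + repr y') = x' + y'.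
  by rewrite to_circleD !reprK_circle.
apply: le_trans (circle_dist_leP xyE xyE') _; apply: le_trans (ler_normD _ _).
by rewrite le_eqVlt; apply/orP; left; apply/eqP; congr `| _ |; lra.
Qed.

End Circle.

Section TwistMap.
Context (R : realType).

Definition heights : set R :=
  [set y | (exists2 n, (1 <= n)%N & y = expR (- n%:R)) \/ y = 0].

Definition twist_space : Type := (circle R * set_type heights)%type.
HB.instance Definition _ := Choice.on twist_space.

Definition twist_dist (p q : twist_space) : R :=
  Num.max (mdist p.1 q.1) `|val q.2 - val p.2|.

Let twist_distxx p : twist_dist p p = 0.
Proof. by rewrite /twist_dist mdistxx subrr normr0 maxxx. Qed.

Let twist_dist_positivity p q : twist_dist p q = 0 -> p = q.
Proof.
case: p q => [x y] [x' y'] /= d0.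
have : twist_dist (x, y) (x', y') <= 0 by rewrite d0.
rewrite /twist_dist ge_max/= normr_le0 subr_eq0 => /andP[d1 /eqP/val_inj <-].
congr pair; apply: (@mdist_positivity R).
by apply/eqP; rewrite eq_le d1 mdist_ge0.
Qed.

Let twist_dist_sym p q : twist_dist p q = twist_dist q p.
Proof. by rewrite /twist_dist metric_sym distrC. Qed.

Let twist_dist_triangle q p r :
  twist_dist p r <= twist_dist p q + twist_dist q r.
Proof.
rewrite /twist_dist ge_max; apply/andP; split.
  apply: le_trans (metric_triangle _ q.1 _) _.
  by apply: lerD; rewrite le_max lexx.
apply: le_trans (ler_distD (val q.2) _ _) _.
by rewrite addrC; apply: lerD; rewrite le_max lexx orbT.
Qed.

HB.instance Definition _ := isMetric.Build R twist_space
  twist_distxx twist_dist_positivity twist_dist_sym twist_dist_triangle.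

Lemma mdist_twistE (p q : twist_space) : mdist p q = twist_dist p q.
Proof. by []. Qed.

Definition twist (p : twist_space) : twist_space :=
  (p.1 + to_circle (val p.2), p.2).

Let untwist (p : twist_space) : twist_space :=
  (p.1 - to_circle (val p.2), p.2).

Let lip2_continuous (g : twist_space -> twist_space) :
  (forall p q, mdist (g p) (g q) <= mdist p q *+ 2) -> continuous g.
Proof.
move=> gl p.
apply: (@metricType_numDomainType.cvgrPdist_lt _ _ _ (nbhs p) _ g (g p)).2 => e e0.
have e2 : 0 < e / 2 by rewrite divr_gt0.
have pe2 : \forall q \near p, mdist p q < e / 2.
  by apply/metricType_numDomainType.nbhs_mdistP; exists (e / 2).
near=> q.
have pq : mdist p q < e / 2 by near: q.
by rewrite (le_lt_trans (gl p q))// mulr2n; lra.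
Unshelve. all: by end_near. Qed.

Lemma twist_homeomorphism : homeomorphism twist.
Proof.
have lip (s : R) (p q : twist_space) : `|s| = 1 ->
    mdist ((p.1 + to_circle (s * val p.2), p.2) : twist_space)
          ((q.1 + to_circle (s * val q.2), q.2) : twist_space)
    <= mdist p q *+ 2.
  move=> s1; rewrite !mdist_twistE /twist_dist/= ge_max; apply/andP; split.
    apply: le_trans (mdist_circleD _ _ _ _) _.
    rewrite mulr2n; apply: lerD; first by rewrite le_max lexx.
    apply: le_trans (circle_dist_le _ _) _.
    by rewrite -mulrBr normrM s1 mul1r distrC le_max lexx orbT.
  by rewrite mulr2n ler_wpDl ?le_max ?mdist_ge0// lexx orbT.
exists untwist; split.
- by case=> x y; rewrite /twist /untwist/= addrK.
- by case=> x y; rewrite /twist /untwist/= subrK.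
- apply: lip2_continuous => p q; have := lip 1 p q (normr1 _).
  by rewrite !mul1r.
- apply: lip2_continuous => p q; have := lip (-1) p q (normrN1 _).
  by rewrite !mulN1r !to_circleN.
Qed.

Let ultra_cvg (T : choiceType) (F : set_system T) (g : T -> R) (K : set R) :
  UltraFilter F -> compact K -> F (g @^-1` K) ->
  exists2 l, K l & g @ F --> l.
Proof.
move=> FU cK FK.
have [l [Kl cl]] := cK (g @ F) _ FK; exists l => // A /cl lA.
have [//|FnA] := in_ultra_setVsetC (g @^-1` A) FU.
by have [z []] := lA (~` A) FnA.
Qed.

Lemma heights_compact : compact heights.
Proof.
rewrite compact_ultra => F FU Fh.
have [[n n1 Fn]|nF] :=
    pselect (exists2 n, (1 <= n)%N & F [set expR (- n%:R : R)]).
  exists (expR (- n%:R)); split; first by left; exists n.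
  by move=> A /nbhs_singleton An; apply: filterS Fn => _ ->.
exists 0; split; first by right.
apply/cvgrPdist_lt => e e0.
have Fm m : F [set y | heights y /\ forall n, (1 <= n <= m)%N -> y <> expR (- n%:R)].
  elim: m => [|m IH].
    by apply: filterS Fh => y hy; split => // n /andP[n1]; rewrite leqn0 => /eqP n0; rewrite n0 in n1.
  have [Fm1|Fm1] := in_ultra_setVsetC [set expR (- m.+1%:R : R)] FU.
    by exfalso; apply: nF; exists m.+1.
  apply: filterS2 IH Fm1 => y [hy ym] ym1; split => // n /andP[n1].
  by rewrite leq_eqVlt => /predU1P[->//|nm]; apply: ym; rewrite n1.
near \oo => m.
apply: filterS (Fm m) => y [[[n n1 ->]|->] ym]; last by rewrite subrr normr0.
have mn : (m < n)%N.
  by rewrite ltnNge; apply/negP => nm; apply: (ym n) => //; rewrite n1.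
rewrite sub0r normrN ger0_norm ?expR_ge0//.
apply: (@lt_trans _ _ (expR (- m%:R))); first by rewrite ltr_expR ltrN2 ltr_nat.
rewrite -[ltRHS]lnK ?posrE// ltr_expR ltrNl.
near: m; exact: nbhs_infty_gtr.
Unshelve. all: by end_near. Qed.

Lemma twist_space_compact : compact [set: twist_space].
Proof.
rewrite compact_ultra => F FU _.
have fr (p : twist_space) : exists2 t : R, `[0, 1]%classic t & to_circle t = p.1.
  exists (repr p.1 - (Num.floor (repr p.1))%:~R).
    have /andP[] := floor_itv (repr p.1).
    by rewrite intrD /= in_itv/= => ? ?; apply/andP; split; lra.
  rewrite -[RHS]reprK_circle; apply/eqP/to_circleP.
  by exists (- Num.floor (repr p.1)); rewrite intrN.
pose g p := s2val (cid2 (fr p)).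
have gI p : `[0, 1]%classic (g p) by rewrite /g; case: cid2.
have gE p : to_circle (g p) = p.1 by rewrite /g; case: cid2.
have [t _ Ft] : exists2 l : R, `[0, 1]%classic l & g @ F --> l.
  apply: ultra_cvg (@segment_compact R 0 1) _.
  by apply: filterS filterT => p _; exact: gI.
have [y hy Fy] : exists2 l : R, heights l & (fun p : twist_space => val p.2) @ F --> l.
  apply: ultra_cvg heights_compact _.
  by apply: filterS filterT => p _; exact: set_valP.
exists (to_circle t, exist _ y (mem_set hy)); split => //.
apply/metricType_numDomainType.fcvgrPdist_lt => e e0.
move/cvgrPdist_lt : Ft => /(_ _ e0) Ft; move/cvgrPdist_lt : Fy => /(_ _ e0) Fy.
apply: filterS2 Ft Fy => p pt py.
rewrite mdist_twistE /twist_dist gt_max/=; apply/andP; split.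
  by rewrite -gE; apply: le_lt_trans (circle_dist_le _ _) _.
by rewrite distrC.
Qed.

End TwistMap.

(* Main.v *)
Require Import Defs.
From HB Require Import structures.
From mathcomp Require Import all_boot all_order all_algebra.
From mathcomp Require Import all_classical all_reals all_analysis.
From mathcomp Require Import finmap lra.

(* On each circle of constant height the map is a rotation, hence an isometry,
   and up to time [n] the orbits at a height at most [e / n] stay [e]-close to
   the fixed points of height [0].  Since [a_j = expR (- j)], only about [ln n]
   heights exceed [e / n], so a net of the circle repeated at each of them is
   spanning: [r_n(e) <= A ln n + B], and [ln (A ln n + B) / ln n] tends to 0. *)

Set Implicit Arguments.
Unset Strict Implicit.
Unset Printing Implicit Defensive.

Import Order.TTheory GRing.Theory Num.Def Num.Theory.
Import numFieldNormedType.Exports.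

Local Open Scope classical_set_scope.
Local Open Scope ring_scope.

(** Only an inequality, because [s] may contain repetitions. *)
Lemma counting_seq_le (R : realType) (T : choiceType) (s : seq T) :
  (counting [set` s] <= (size s)%:R%:E :> \bar R)%E.
Proof.
have -> : [set` s] = [set` [fset x in s]%fset].
  by apply/seteqP; split => x /=; rewrite in_fset_.
rewrite /counting asboolT; last exact: finite_fset.
by rewrite lee_fin ler_nat set_fsetK card_fseq size_undup.
Qed.

(** Makes the logarithm of the spanning number nonnegative: the lower half of the final squeeze. *)
Lemma span_num_ge1 (R : realType) (X : metricType R) (f : X -> X) (x : X) n
  (e : R) : (1 <= span_num f n e)%E.
Proof.
apply: le_ereal_inf_tmp => _ [E sE <-]; have [y Ey _] := sE x.
rewrite /counting; case: asboolP => [finE|_]; last exact: leey.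
rewrite lee_fin ler1n cardfs_gt0; apply/fset0Pn; exists y.
by rewrite in_fset_set//; exact: mem_set.
Qed.

(** For [S = A * ln n + B] and any [c > 0], [ln S = ln (c * S) - ln c < c * S - ln c]. A small [c]
    makes the slope in [ln n] at most [d / 2]. *)
Lemma cvg_ln_affine_ln_div (R : realType) (A B : R) : 0 <= A -> 1 <= B ->
  ln (A * ln n%:R + B) / ln n%:R @[n --> \oo] --> 0.
Proof.
move=> A0 B1; apply/cvgrPdist_le => d d0.
(* Dividing by [A + 1] covers the case [A = 0]. *)
pose c := d / (A + 1) / 2.
have c0 : 0 < c by rewrite !divr_gt0//; lra.
have cA : c * A <= d / 2.
  rewrite /c mulrAC ler_wpM2r ?invr_ge0//.
  by rewrite mulrAC ler_pdivrMr; [rewrite ler_wpM2l; lra|lra].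
near=> n.
have n1 : 1 < n%:R :> R by rewrite ltr1n; near: n; exact: nbhs_infty_gt.
have l0 : 0 < ln (n%:R : R) by rewrite ln_gt0.
(* For large [n] the constant terms cost at most the other [d / 2 * ln n]. *)
have lb : (c * B - ln c) * 2 / d <= ln (n%:R : R).
  rewrite -ler_expR lnK ?posrE//; last lra.
  by near: n; exact: nbhs_infty_ger.
set L := ln n%:R in l0 lb *.
have S1 : 1 <= A * L + B by have := mulr_ge0 A0 (ltW l0); lra.
rewrite sub0r normrN ger0_norm; last by rewrite divr_ge0 ?ln_ge0// ltW.
rewrite ler_pdivrMr//.
have -> : ln (A * L + B) = ln (c * (A * L + B)) - ln c.
  by rewrite lnM ?posrE//; lra.
have := @ln_sublinear R (c * (A * L + B)) ltac:(by rewrite mulr_gt0//; lra).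
move: lb; rewrite ler_pdivrMr// => lb.
have := ler_wpM2r (ltW l0) cA; lra.
Unshelve. all: by end_near. Qed.

(** With [N > 1 / d], rounding a representative in [0, 1) down to a multiple of [1 / N] moves it by
    at most [d]. *)
Lemma circle_net (R : realType) (d : R) : 0 < d ->
  exists s : seq (circle R), forall x, exists2 z, z \in s & mdist z x <= d.
Proof.
move=> d0; pose N := (Num.truncn d^-1).+1.
have N0 : 0 < N%:R :> R by [].
exists [seq to_circle (i%:R / N%:R) | i <- iota 0 N] => x.
pose t : R := repr x - (Num.floor (repr x))%:~R.
have /andP[t0 t1] : 0 <= t < 1.
  have /andP[] := floor_itv (repr x).
  by rewrite /t intrD => ? ?; apply/andP; split; lra.
have tx : to_circle t = x.
  rewrite -[RHS]reprK_circle; apply/eqP/to_circleP.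
  by exists (- Num.floor (repr x)); rewrite intrN.
have tN : 0 <= t * N%:R by rewrite mulr_ge0.
have /andP[i1 i2] := truncn_itv tN.
set i := Num.truncn _ in i1 i2.
exists (to_circle (i%:R / N%:R)).
  apply/mapP; exists i => //; rewrite mem_iota/= add0n -(ltr_nat R).
  by apply: le_lt_trans i1 _; rewrite gtr_pMl.
rewrite -tx mdist_circleE; apply: le_trans (circle_dist_le _ _) _.
have -> : i%:R / N%:R - t = (i%:R - t * N%:R) / N%:R.
  by rewrite mulrBl mulfK// gt_eqF.
rewrite normrM (gtr0_norm (x := N%:R^-1)) ?invr_gt0// ler_pdivrMr//.
apply: (@le_trans _ _ 1).
  rewrite -natr1 in i2.
  by rewrite ler_norml; apply/andP; split; lra.
rewrite -ler_pdivrMl// mulr1; exact/ltW/truncnS_gt.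
Qed.

(** The net keeps 0 and the heights [expR (- j)] with [j <= m], where [m > ln (n / d)]. Every lower
    height is at most [d / n], so 0 stands in for it. *)
Lemma heights_net (R : realType) (d : R) (n : nat) : 0 < d -> (0 < n)%N ->
  exists s : seq (set_type (@heights R)),
    (size s)%:R <= ln n%:R + `|ln d| + 2 /\
    forall y : set_type (@heights R),
      exists2 z, z \in s & `|val z - val y| *+ n <= d.
Proof.
move=> d0 n0; pose m := (Num.truncn (ln (n%:R / d))).+1.
(* The exponential heights start at [j = 1], so index 0 can encode the height 0. *)
pose v j : R := if j is j'.+1 then expR (- j%:R) else 0.
have hv j : heights (v j) by case: j => [|j]; [right|left; exists j.+1].
pose h j : set_type (@heights R) := exist _ (v j) (mem_set (hv j)).
have nR : 0 < n%:R :> R by rewrite ltr0n.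
exists [seq h j | j <- iota 0 m.+1]; split.
  have := ler_norm (ln d); have := ln_ge0 (ltac:(by rewrite ler1n) : 1 <= n%:R :> R).
  rewrite size_map size_iota -!natr1 => l0 _.
  (* The absolute value is there because [ln (n / d)] is negative when [n < d]. *)
  have : (Num.truncn (ln (n%:R / d)))%:R <= `|ln (n%:R / d)|.
    apply: le_trans (_ : (Num.truncn `|ln (n%:R / d)|)%:R <= _).
      by rewrite ler_nat le_truncn// ler_norm.
    by rewrite truncn_le.
  rewrite ln_div ?posrE//.
  have := ler_normB (ln n%:R) (ln d); rewrite (ger0_norm l0); lra.
have small j : (m < j)%N -> expR (- j%:R) *+ n <= d :> R.
  move=> mj; rewrite -[leLHS]mulr_natr -ler_pdivlMr// -[leRHS]lnK ?posrE ?divr_gt0//.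
  rewrite ler_expR -[d / _]invf_div lnV ?posrE ?divr_gt0// lerN2.
  apply/ltW/(lt_trans (truncnS_gt _)); rewrite ltr_nat; exact: mj.
have inh j : (j <= m)%N -> h j \in [seq h j | j <- iota 0 m.+1].
  by move=> jm; apply: map_f; rewrite mem_iota.
move=> y; have [[j j0 yj]|y0] := set_valP y; last first.
  by exists (h 0%N); [exact: inh|rewrite /= y0 subrr normr0 mul0rn ltW].
have yv : val y = v j by rewrite yj; case: j j0 {yj}.
have [jm|mj] := leqP j m.
  by exists (h j); [exact: inh|rewrite yv subrr normr0 mul0rn ltW].
exists (h 0%N); first exact: inh.
by rewrite /= yj sub0r normrN ger0_norm ?expR_ge0// small.
Qed.

Lemma iter_twist (R : realType) k (p : twist_space R) :
  iter k (@twist R) p = (p.1 + to_circle (val p.2 *+ k), p.2).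
Proof.
elim: k => [|k /= ->].
  (* Writing 0 as [0 - 0] yields [to_circle 0 = 0]. *)
  rewrite mulr0n -[0]subr0 to_circleD to_circleN addrN addr0.
  by case: p.
by rewrite /twist/= mulrSr to_circleD addrA.
Qed.

(** Two orbits drift apart at most linearly, by the height gap at each step. *)
Lemma mdist_iter_twist (R : realType) k n (p q : twist_space R) : (k < n)%N ->
  mdist (iter k (@twist R) p) (iter k (@twist R) q) <=
  mdist p.1 q.1 + `|val p.2 - val q.2| *+ n.
Proof.
move=> kn; rewrite !iter_twist mdist_twistE /twist_dist/= ge_max.
apply/andP; split.
  apply: le_trans (mdist_circleD _ _ _ _) _; apply: lerD => //.
  apply: le_trans (circle_dist_le _ _) _.
  by rewrite -mulrnBl normrMn ler_wpMn2l// ltnW.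
(* The height gap itself is one of the [n] copies, as [k < n] forces [n >= 1]. *)
rewrite distrC -[leLHS]mulr1n -[leLHS]add0r lerD ?mdist_ge0//.
by rewrite ler_wpMn2l// (leq_trans _ kn).
Qed.

Lemma span_num_twist_le (R : realType) (e : R) : 0 < e ->
  exists A B : R, [/\ 0 <= A, 1 <= B & forall n, (0 < n)%N ->
    (span_num (@twist R) n e <= (A * ln n%:R + B)%:E)%E].
Proof.
move=> e0; have e20 : 0 < e / 2 by rewrite divr_gt0.
have [s sP] := circle_net e20.
(* Half of [e] goes to the circle net, which does not depend on [n], and half to the drift. The
   final [+ 1] ensures [B >= 1]. *)
exists (size s)%:R, ((size s)%:R * (`|ln (e / 2)| + 2) + 1); split => //.
  by rewrite lerDr mulr_ge0// addr_ge0.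
move=> n n0; have [t [t1 tP]] := heights_net e20 n0.
pose E : seq (twist_space R) := [seq (x, y) | x <- s, y <- t].
apply: ge_ereal_inf; exists (counting [set` E]).
  exists [set` E] => // -[x y].
  have [x' x's xx'] := sP x; have [y' y't yy'] := tP y.
  exists (x', y'); first by apply/allpairsP; exists (x', y').
  move=> k kn; apply: le_trans (mdist_iter_twist _ _ kn) _ => /=.
  by rewrite [e]splitr lerD.
apply: le_trans (counting_seq_le _ _) _.
rewrite lee_fin size_allpairs natrM.
have := ler_wpM2l (ler0n R (size s)) t1; lra.
Qed.

Lemma pol_entropy_eps_twist (R : realType) (e : R) : 0 < e ->
  pol_entropy_eps (@twist R) e = 0%E.
Proof.
move=> e0; have [A [B [A0 B1 AB]]] := span_num_twist_le e0.
rewrite /pol_entropy_eps; suff /cvg_limn_einf_sup[_ ->] :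
  (fun n => lne (span_num (@twist R) n e) / (ln n%:R)%:E)%E @ \oo --> 0%E by [].
have p : twist_space R := (0, exist _ 0 (mem_set (or_intror erefl))).
apply: (@squeeze_cvge _ _ _ _ (cst 0%E) _
  (fun n => (ln (A * ln n%:R + B) / ln n%:R)%:E)); last 2 first.
- exact: cvg_cst.
- by apply: cvg_EFin; [near=> n|exact: cvg_ln_affine_ln_div].
near=> n.
have n1 : (1 < n)%N by near: n; exact: nbhs_infty_gt.
have l0 : 0 < ln (n%:R : R) by rewrite ln_gt0// ltr1n.
have s1 := span_num_ge1 (@twist R) p n e.
rewrite mule_ge0 ?lne_ge0 ?inve_ge0 ?lee_fin ?(ltW l0)//=.
rewrite EFinM inver gt_eqF// lee_wpmul2r ?lee_fin ?invr_ge0 ?(ltW l0)//.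
have S0 : 0 < A * ln n%:R + B by have := mulr_ge0 A0 (ltW l0); lra.
rewrite -lne_EFin// lee_lne ?AB ?(ltnW n1)// in_itv/= leey andbT.
  exact: le_trans s1.
by rewrite lee_fin ltW.
Unshelve. all: by end_near. Qed.

Theorem proposition3p3 (R : realType) : pol_entropy (@twist R) = 0%E.
Proof.
(* The entropy at scale [e] vanishes for every [e > 0], so the limit is that of a constant. *)
apply: cvg_lim => //; apply: cvg_near_cst.
by near=> e; apply: pol_entropy_eps_twist.
Unshelve. all: by end_near. Qed.
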